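(* For every $n$ and every $j\in[2,n-1]$, the action of the Knuth generator $K_j$ on $S_n$ commutes with the actions on $S_n$ (via insertion tableaux) of $d_i^R$ (for every $i\in[2,n-2]$), of $\mathrm{slink}$, and of $\mathrm{slink}_*$.
   Context: Tableaux. Partition diagrams are in French notation: left-justified, rows numbered from bottom to top, row $r$ having $\lambda_r$ cells. $\mathrm{SYT}(\lambda)$ is the set of fillings of $\lambda\vdash n$ by $1,\dots,n$ (each used once), increasing left to right along rows and bottom to top up columns. The superstandard tableau $U_\lambda$ is the one whose bottom row is $1,\dots,\lambda_1$, whose second row is $\lambda_1+1,\dots,\lambda_1+\lambda_2$, and so on. The row reading word $\mathrm{rw}(T)$ reads each row left to right, starting with the top row and going down; cells are ordered by this reading order. For a permutation $\pi\in S_n$ in one-line notation, $\mathrm{ID}(\pi)$ is the set of $i\in[n-1]$ such that $i$ occurs to the right of $i+1$; $\mathrm{ID}(T)=\mathrm{ID}(\mathrm{rw}(T))$. Runs. Write $\mathrm{ID}(T)\cup\{n\}=\{b_1<\dots<b_m\}$, $b_0=0$. The $r$-th run of $T$ is the set of cells with entries in $(b_{r-1},b_r]$; $\beta_r(T)=b_r-b_{r-1}$. Within a run, entries increase in reading order, so $T$ is determined by the sequence of cell sets of its runs. The first $r$ runs of $T$ form the standard Young tableau consisting of entries $\le b_r$. The maps $\mathrm{slink},\mathrm{slink}_*$ on $\mathrm{SYT}(\lambda)$. Let $j$ be minimal such that the first $j$ runs of $T$ do not form a superstandard tableau. If no such $j$ exists ($T=U_\lambda$), both maps fix $T$. Otherwise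 ($j\ge2$): (1) $\mathrm{slink}(T)$ has the same runs as $T$ except runs $j-1$ and $j$: among the cells of runs $j-1$ and $j$ of $T$ lying strictly below row $j$, the first $\beta_j(T)-1$ in reading order form the new $(j-1)$-th run, and the remaining ones together with the cells of run $j$ in row $j$ form the new $j$-th run. (2) Let $\mu$ be the shape of the first $j$ runs of $T$ and let $i\ge1$ be minimal with $\mu_{i+1}\le\beta_j(T)+i-j$ (so $i\le j-1$). $\mathrm{slink}_*(T)$ has the same runs as $T$ except runs $i$ and $j$: among the cells of runs $i$ and $j$ of $T$ lying strictly below row $i+1$, the first $\beta_j(T)+i-j$ in reading order form the new $i$-th run, and the remaining ones together with the cells of run $j$ in rows $\ge i+1$ form the new $j$-th run. Elementary dual equivalence. $d_i$ acts on a permutation by: $\ldots i\ldots i-1\ldots i+1\ldots\leftrightarrow\ldots i+1\ldots i-1\ldots i\ldots$ and $\ldots i\ldots i+1\ldots i-1\ldots\leftrightarrow\ldots i-1\ldots i+1\ldots i\ldots$ (all else fixed), and as the identity if $i$ is between $i-1$ and $i+1$. It acts on $\mathrm{SYT}(\lambda)$ through $\mathrm{rw}$. For $i\in[2,n-2]$, $d_i^R(T)=T$ if $i+1\in\mathrm{ID}(T)\cap\mathrm{ID}(d_i(T))$, and $d_i^R(T)=d_i(T)$ otherwise. Permutations. The RSK correspondence (row insertion) sends $\pi\in S_n$ to $(P(\pi),Q(\pi))$, insertion and recording tableaux. A map $\phi$ on standard Young tableaux preserving each $\mathrm{SYT}(\lambda)$ (here $\phi=d_i^R,\mathrm{slink},\mathrm{slink}_*$)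 acts on $S_n$ via insertion tableaux: $\phi(\pi)$ is the unique permutation $\pi'$ with $P(\pi')=\phi(P(\pi))$ and $Q(\pi')=Q(\pi)$. The Knuth generator is $K_j(\pi)=(d_j(\pi^{-1}))^{-1}$. *)

(* Defs.v *)
From mathcomp Require Import all_boot all_fingroup.

Set Implicit Arguments.
Unset Strict Implicit.
Unset Printing Implicit Defensive.

(* Permutations of [n] are elements of 'S_n, one-line notation is a word of
   type seq nat with letters 1, ..., n.  A tableau is the sequence of its rows
   listed from bottom to top (French notation), without empty rows. *)

Definition tableau := seq (seq nat).

(* A cell is a pair (row, column), both counted from 1. *)
Definition cell := (nat * nat)%type.

Definition word (n : nat) (s : 'S_n) : seq nat := [seq (s k : nat).+1 | k : 'I_n].

(* The default value 1 is only returned if w is not a permutation of 1 ... n. *)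
Definition perm_of_word (n : nat) (w : seq nat) : 'S_n :=
  odflt 1%g [pick s : 'S_n | word s == w].

(** * Words and elementary dual equivalence *)

Definition occurs_before (w : seq nat) (a b : nat) : bool := index a w < index b w.

Definition occurs_between (w : seq nat) (a b c : nat) : bool :=
  (occurs_before w a b && occurs_before w b c)
  || (occurs_before w c b && occurs_before w b a).

Definition swap_letters (a b : nat) (w : seq nat) : seq nat :=
  map [eta id with a |-> b, b |-> a] w.

Definition ID_word (w : seq nat) : seq nat :=
  [seq i <- iota 1 (size w).-1 | occurs_before w i.+1 i].

Definition d_word (i : nat) (w : seq nat) : seq nat :=
  if occurs_between w i i.-1 i.+1 then swap_letters i i.+1 w
  else if occurs_between w i i.+1 i.-1 then swap_letters i.-1 i w
  else w.

Definition d_perm (n i : nat) (s : 'S_n) : 'S_n := perm_of_word n (d_word i (word s)).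

Definition knuth (n j : nat) (s : 'S_n) : 'S_n := ((d_perm j (s^-1))^-1)%g.

(** * Tableaux *)

Definition superstandard (la : seq nat) : tableau := reshape la (iota 1 (sumn la)).

Definition rw (T : tableau) : seq nat := flatten (rev T).

(* The tableau of the same shape as T whose row reading word is w. *)
Definition fill_rw (T : tableau) (w : seq nat) : tableau :=
  rev (reshape (shape (rev T)) w).

Definition ID (T : tableau) : seq nat := ID_word (rw T).

Definition d_tab (i : nat) (T : tableau) : tableau := fill_rw T (d_word i (rw T)).

Definition dR (i : nat) (T : tableau) : tableau :=
  if (i.+1 \in ID T) && (i.+1 \in ID (d_tab i T)) then T else d_tab i T.

(** * Runs *)

(* All cells of the diagram of la, in reading order. *)
Definition cells (la : seq nat) : seq cell :=
  flatten [seq [seq (r, c) | c <- iota 1 (nth 0 la r.-1)] | r <- rev (iota 1 (size la))].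

Definition entry (T : tableau) (x : cell) : nat := nth 0 (nth [::] T x.1.-1) x.2.-1.

(* The sequence b_0 = 0 < b_1 < ... < b_m = n. *)
Definition breaks (T : tableau) : seq nat := 0 :: rcons (ID T) (size (rw T)).

Definition brk (T : tableau) (r : nat) : nat := nth 0 (breaks T) r.

Definition nruns (T : tableau) : nat := (size (ID T)).+1.

Definition beta (T : tableau) (r : nat) : nat := brk T r - brk T r.-1.

(* The cells of the r-th run (r >= 1), in reading order. *)
Definition run (T : tableau) (r : nat) : seq cell :=
  [seq x <- cells (shape T) | brk T r.-1 < entry T x <= brk T r].

Definition first_runs (T : tableau) (r : nat) : tableau :=
  [seq row <- [seq [seq e <- row | e <= brk T r] | row <- T] | row != [::]].

Definition is_superstandard (T : tableau) : bool := T == superstandard (shape T).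

(* The minimal j such that the first j runs of T are not superstandard. *)
Definition first_bad_run (T : tableau) : option nat :=
  ohead [seq j <- iota 1 (nruns T) | ~~ is_superstandard (first_runs T j)].

(* The filling of la determined by its successive runs R, given as lists of
   cells; the order in which each list is given is irrelevant. *)
Definition tableau_of_runs (la : seq nat) (R : seq (seq cell)) : tableau :=
  let order := flatten [seq [seq x <- cells la | x \in C] | C <- R] in
  [seq [seq (index (r, c) order).+1 | c <- iota 1 (nth 0 la r.-1)]
     | r <- iota 1 (size la)].

(* Redistribution of the runs a < j: among the cells of these runs strictly
   below row h, the first k form the new run a; the others, together with the
   cells of run j whose row satisfies keep, form the new run j. *)
Definition rerun (T : tableau) (a j h k : nat) (keep : pred nat) : tableau :=
  let low := [seq x <- cells (shape T) | (x \in run T a ++ run T j) && (x.1 < h)] in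
  let new_a := take k low in
  let new_j := drop k low ++ [seq x <- run T j | keep x.1] in
  tableau_of_runs (shape T)
    [seq if r == a then new_a else if r == j then new_j else run T r
       | r <- iota 1 (nruns T)].

Definition slink (T : tableau) : tableau :=
  if first_bad_run T is Some j then
    rerun T j.-1 j j (beta T j).-1 (fun r => r == j)
  else T.

(* mu_{i+1} <= beta_j + i - j is written mu_{i+1} + j <= beta_j + i, as the
   right-hand side of the former may be negative.  It holds for i = j - 1, so
   the minimal i is found in [1, j - 1]. *)
Definition slink_star_index (T : tableau) (j : nat) : nat :=
  let mu := shape (first_runs T j) in
  head 0 [seq i <- iota 1 j.-1 | nth 0 mu i + j <= beta T j + i].

Definition slink_star (T : tableau) : tableau :=
  if first_bad_run T is Some j then
    let i := slink_star_index T j in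
    rerun T i j i.+1 (beta T j + i - j) (fun r => i.+1 <= r)
  else T.

(** * RSK *)

(* Row insertion of x; also returns the index (from 0) of the row in which a
   cell is created. *)
Fixpoint row_insert (T : tableau) (x : nat) : tableau * nat :=
  if T is row :: T' then
    if has (ltn x) row then
      let k := find (ltn x) row in
      let: (T'', r) := row_insert T' (nth 0 row k) in
      (set_nth 0 row k x :: T'', r.+1)
    else (rcons row x :: T', 0)
  else ([:: [:: x]], 0).

Definition rsk_step (PQ : tableau * tableau) (x : nat) : tableau * tableau :=
  let: (P, Q) := PQ in
  let: (P', r) := row_insert P x in
  (P', set_nth [::] Q r (rcons (nth [::] Q r) (size (flatten Q)).+1)).

Definition rsk (w : seq nat) : tableau * tableau := foldl rsk_step ([::], [::]) w.

Definition Ptab (n : nat) (s : 'S_n) : tableau := (rsk (word s)).1.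

Definition Qtab (n : nat) (s : 'S_n) : tableau := (rsk (word s)).2.

(* The action of phi on permutations via insertion tableaux.  When phi
   preserves the standard Young tableaux of each shape, there is exactly one
   such t, and the default value s is never used. *)
Definition act_on_perm (n : nat) (phi : tableau -> tableau) (s : 'S_n) : 'S_n :=
  odflt s [pick t : 'S_n | (Ptab t == phi (Ptab s)) && (Qtab t == Qtab s)].

(* Main.v *)
(** Row insertion is unchanged by Knuth moves, and a Knuth move at positions
    j-1, j, j+1 changes the recording tableau in a way that depends on the
    recording tableau only.  As permutations are determined by their pairs of
    tableaux, the Knuth generator, an involution, therefore commutes with the
    action of an arbitrary map phi on insertion tableaux: it acts on the
    recording tableau alone, phi on the insertion tableau alone. *)
Require Import Defs.
From mathcomp Require Import all_boot all_fingroup.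
From mathcomp Require Import zify.

Set Implicit Arguments.
Unset Strict Implicit.
Unset Printing Implicit Defensive.

(** * Insertion into a row *)

(* The bumped letter is [None], to be thought of as an infinite letter, when
   the inserted one is appended at the end of the row. *)
Fixpoint row_bump (row : seq nat) (x : nat) : option nat * seq nat :=
  if row is a :: row' then
    if x < a then (Some a, x :: row')
    else let: (o, row'') := row_bump row' x in (o, a :: row'')
  else (None, [:: x]).

Definition ole (o1 o2 : option nat) : bool :=
  match o1, o2 with
  | _, None => true
  | Some a, Some b => a <= b
  | None, Some _ => false
  end.

Definition olt (o1 o2 : option nat) : bool := ~~ ole o2 o1.

Lemma row_bumpE (row : seq nat) (x : nat) :
  row_bump row x =
    if has (ltn x) row then
      let k := find (ltn x) row in (Some (nth 0 row k), set_nth 0 row k x)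
    else (None, rcons row x).
Proof.
elim: row => //= a row ->.
by case: ltnP => //= _; case: ifP.
Qed.

Lemma row_bump_gt (row : seq nat) (x : nat) : olt (Some x) (row_bump row x).1.
Proof.
elim: row => //= a row.
case: ltnP => [xa _|_]; first by rewrite /olt /= -ltnNge.
by case: (row_bump row x).
Qed.

Lemma row_bump_all_ge (a : nat) (row : seq nat) (x : nat) :
    all (leq a) row -> a <= x ->
  ole (Some a) (row_bump row x).1 && all (leq a) (row_bump row x).2.
Proof.
move=> + ax; elim: row => [|b row IH] /=; first by rewrite ax.
case/andP=> ab arow; case: ltnP => [xb|bx] /=; first by rewrite ab ax arow.
by move: (IH arow); case: (row_bump row x) => o row' /= /andP[-> ->]; rewrite ab.
Qed.

Lemma row_bump_sorted (row : seq nat) (x : nat) :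
  sorted leq row -> sorted leq (row_bump row x).2.
Proof.
elim: row => //= a row IH; rewrite (path_sortedE leq_trans) => /andP[arow srow].
case: ltnP => [xa|ax] /=.
  rewrite (path_sortedE leq_trans) srow andbT.
  by apply: sub_all arow => y; apply: leq_trans (ltnW xa).
have /andP[_] := row_bump_all_ge arow ax; move: (IH srow).
case: (row_bump row x) => o row' /= srow' arow'.
by rewrite (path_sortedE leq_trans) arow'.
Qed.

Lemma mem_row_bump (row : seq nat) (x : nat) : x \in (row_bump row x).2.
Proof.
elim: row => [|a row IH] /=; first by rewrite mem_head.
case: ltnP => _; first by rewrite mem_head.
by case: (row_bump row x) IH => o row' /=; rewrite inE orbC => ->.
Qed.

Lemma row_bump_None (row row' : seq nat) (x : nat) :
  row_bump row x = (None, row') -> row' = rcons row x.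
Proof. by rewrite row_bumpE; case: ifP => // _ [<-]. Qed.

Lemma row_bump_nonempty (row : seq nat) (x : nat) : (row_bump row x).2 != [::].
Proof. by apply/eqP => E; have := mem_row_bump row x; rewrite E. Qed.

(** Reverse bumping. If nothing is bumped, the inserted letter is the last of the new row; otherwise
    both bumps must take place at the same position, where the old letter is the bumped one. *)
Lemma row_bump_inj (row1 row2 : seq nat) (x1 x2 : nat) :
    sorted leq row1 -> sorted leq row2 ->
    row_bump row1 x1 = row_bump row2 x2 ->
  row1 = row2 /\ x1 = x2.
Proof.
move=> s1 s2 E; case F: (row_bump row2 x2) (E) => [[b|] row'] {}E; last first.
  by move/row_bump_None: F; rewrite (row_bump_None E) => /rcons_inj[-> ->].
(* The inserted letter lies in the new row and is smaller than the bumped letter [a]. This rules out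
   a bump at the head of one row and in the tail of the other. *)
have contra a y row0 row : all (leq a) row -> ~ row_bump row0 y = (Some a, row).
  move=> arow R; have := row_bump_gt row0 y; have := mem_row_bump row0 y.
  by rewrite R /olt /= => /(allP arow) /= ->.
elim: row1 row2 row' s1 s2 E F => [|a1 row1 IH] [|a2 row2] row' //=.
rewrite !(path_sortedE leq_trans) => /andP[a1r s1] /andP[a2r s2].
case: ltnP => [x1a|ax1]; case: ltnP => [x2a|ax2].
- by case=> -> <- [-> -> ->].
- case=> Eb <-; case R: (row_bump row2 x2) => [o r] [Eo _ Er].
  by rewrite Eo Er -Eb in R; case: (contra _ _ _ _ a1r R).
- case R: (row_bump row1 x1) => [o r] [Eo <-] [Eb _ Er].
  by rewrite Eo -Er -Eb in R; case: (contra _ _ _ _ a2r R).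
case R1: (row_bump row1 x1) => [o1 r1] [E1 <-].
case R2: (row_bump row2 x2) => [o2 r2] [E2 <- Er].
rewrite E1 in R1; rewrite E2 Er in R2.
by have [-> ->] := IH _ _ s1 s2 R1 R2.
Qed.

(** If [x <= y], then [y] acts to the right of [x], where all letters are at least the one that [x]
    bumped. Otherwise [y] bumps [x] or a letter to its left, hence less than what [x] bumped. *)
Lemma row_bump_ole (row : seq nat) (x y : nat) : sorted leq row ->
  let: (ox, row') := row_bump row x in
  ole ox (row_bump row' y).1 = (x <= y).
Proof.
elim: row => [|a row IH] /=; first by move=> _; case: ltnP.
rewrite (path_sortedE leq_trans) => /andP[arow srow].
case: ltnP => [xa|ax] /=.
  case: ltnP => [yx|xy]; first by rewrite /= leqNgt xa.
  suff: ole (Some a) (row_bump row y).1 by case: (row_bump row y).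
  case: (leqP a y) => [ay|ya]; first by have /andP[] := row_bump_all_ge arow ay.
  case: row arow {IH srow} => //= b row /andP[ab _].
  by rewrite (leq_trans ya ab).
move: (IH srow) (row_bump_gt row x) (row_bump_all_ge arow ax).
case: (row_bump row x) => o row' /= + xo.
case: ltnP => [ya _|ay]; last by case: (row_bump row' y).
case: o xo => [o|] /= xo; last by move=> _; lia.
by case/andP=> ao _; move: xo ao; rewrite /olt /= -ltnNge; lia.
Qed.

(** * Knuth moves *)

(* The elementary Knuth relations x z y ~ z x y for x <= y < z, and
   y x z ~ y z x for x < y <= z. *)
Definition knuth_move (a b : option nat * option nat * option nat) : Prop :=
  let: (a1, a2, a3) := a in
  [/\ b = (a2, a1, a3), ole a1 a3 & olt a3 a2]
  \/ [/\ b = (a1, a3, a2), olt a2 a1 & ole a1 a3].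

Definition row_bump3 (row : seq nat) (x y z : nat) :=
  let: (ox, row1) := row_bump row x in
  let: (oy, row2) := row_bump row1 y in
  let: (oz, row3) := row_bump row2 z in
  ((ox, oy, oz), row3).

Definition knuth_or_sym a b := knuth_move a b \/ knuth_move b a.

(** Letters [a <= x] of the row are passed by all three, so let [x < a]. If [a <= z], then [z] and
    [y] act on the tail only and the bumped triple undergoes a move of the same kind. If [z < a],
    the three letters compete for the first two places, and the bumped triple undergoes a reversed
    move of the other kind. *)
Lemma row_bump3_knuth1 (row : seq nat) (x y z : nat) :
    sorted leq row -> x <= y < z ->
  let: (o, row1) := row_bump3 row x z y in
  let: (o', row2) := row_bump3 row z x y in
  row1 = row2 /\ knuth_or_sym o o'.
Proof.
move=> + /andP[xy yz]; have xz := leq_ltn_trans xy yz; rewrite /row_bump3.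
elim: row => [_|a row IH].
  rewrite /= (ltnNge z x) (ltnW xz) /= (ltnNge y x) xy /= yz xz /=.
  by rewrite (ltnNge y x) xy; split => //; right; right.
rewrite /= (path_sortedE leq_trans) => /andP[arow srow].
have [xa|ax] /= := ltnP x a; last first.
  have az : a <= z by lia.
  have ay : a <= y by lia.
  rewrite ltnNge az /=; move: (IH srow).
  case: (row_bump row x) => o1 r1 /=.
  case: (row_bump row z) => o1' r1' /=; rewrite !(ltnNge _ a) az ax /=.
  case: (row_bump r1 z) => o2 r2 /=.
  case: (row_bump r1' x) => o2' r2' /=; rewrite !(ltnNge _ a) ay /=.
  case: (row_bump r2 y) => o3 r3 /=.
  by case: (row_bump r2' y) => o3' r3' /= [-> ?].
rewrite (ltnNge z x) (ltnW xz) /=.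
have [za|az] /= := ltnP z a.
  rewrite xz.
  case: row arow srow IH => [|b row] /=.
    rewrite (ltnNge y x) xy /= yz => _ _ _.
    by split => //; right; right; split=> //; rewrite /olt /= -ltnNge.
  move=> /andP[ab _] _ _; have [zb yb] : z < b /\ y < b by lia.
  rewrite zb (ltnNge y x) xy /= yz (ltnNge y x) xy /= yb.
  by split => //; right; right; split=> //; rewrite /olt /= -ltnNge.
have := row_bump_ole z y srow.
have /andP[] := row_bump_all_ge arow az.
case: (row_bump row z) => oz r /= aoz ar; rewrite xa (ltnNge y x) xy /=.
rewrite (ltnNge y x) xy /=.
(* Even if [y < a], the letter [y] bumps the head of [r], which is at least [a]. *)
have : ole (Some a) (row_bump r y).1.
  case: (leqP a y) => [ay|ya]; first by have /andP[] := row_bump_all_ge ar ay.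
  by case: r {aoz} ar => //= b r /andP[ab _]; rewrite (leq_trans ya ab).
case: (row_bump r y) => oy r' /= aoy oyz.
by split => //; left; left; split=> //; rewrite /olt oyz -ltnNge.
Qed.

(** At the first letter [a > x], the letter [z] acts on the tail, while [x] bumps [y] if [y < a] and
    [a] otherwise. Either way [x] bumps less than [y] does, and [y] at most what [z] does: the move
    keeps its kind. *)
Lemma row_bump3_knuth2 (row : seq nat) (x y z : nat) :
    sorted leq row -> x < y <= z ->
  let: (o, row1) := row_bump3 row y x z in
  let: (o', row2) := row_bump3 row y z x in
  row1 = row2 /\ knuth_or_sym o o'.
Proof.
move=> + /andP[xy yz]; have xz := leq_trans xy yz; rewrite /row_bump3.
elim: row => [_|a row IH].
  rewrite /= xy (ltnNge z y) yz /= xy (ltnNge z x) (ltnW xz) /=.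
  by split => //; left; right.
rewrite /= (path_sortedE leq_trans) => /andP[arow srow].
have [ya|ay] /= := ltnP y a.
  rewrite xy (ltnNge z y) yz /= (ltnNge z x) (ltnW xz) /=.
  have : ole (Some a) (row_bump row z).1.
    case: (leqP a z) => [az|za]; first by have /andP[] := row_bump_all_ge arow az.
    by case: row arow {IH srow} => //= b r /andP[ab _]; rewrite (leq_trans za ab).
  case: (row_bump row z) => oz r' /= aoz; rewrite xy.
  by split => //; left; right; split=> //; rewrite /olt /= -ltnNge.
have az := leq_trans ay yz.
have := row_bump_ole y z srow; move: (IH srow) (row_bump_gt row y).
case: (row_bump row y) => oy r /=; rewrite !(ltnNge _ a) az /=.
have [ax|xa] /= := leqP a x.
  case: (row_bump r x) => o1 r1 /=; rewrite ltnNge az /=.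
  case: (row_bump r1 z) => o2 r2 /=.
  case: (row_bump r z) => o1' r1' /=; rewrite ltnNge ax /=.
  by case: (row_bump r1' x) => o2' r2' /= [-> ?].
move=> _; rewrite (ltnNge z x) (ltnW xz) /=.
case: (row_bump r z) => oz r' /= yoy oyz; rewrite xa.
split => //; left; right; split=> //; last by rewrite oyz.
by case: oy yoy {oyz} => // oy; rewrite /olt /= -!ltnNge; lia.
Qed.

(** * Insertion into a tableau *)

(** Continues an insertion with the letter bumped from the row below [T]. Rows are counted from that
    row, so index 0 says that the new cell lies there. *)
Definition option_insert (T : tableau) (o : option nat) : tableau * nat :=
  if o is Some x then
    let: (T', r) := row_insert T x in (T', r.+1)
  else (T, 0).

Definition row_ok (row : seq nat) : bool := (row != [::]) && sorted leq row.

Definition tab_ok (T : tableau) : bool := all row_ok T.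

Lemma row_insert_cons (row : seq nat) (T : tableau) (x : nat) :
  row_insert (row :: T) x =
    let: (o, row') := row_bump row x in
    let: (T', r) := option_insert T o in (row' :: T', r).
Proof. by rewrite /= row_bumpE; case: ifP => //= _; case: (row_insert T _). Qed.

Lemma option_insert_ok (T : tableau) (o : option nat) :
  tab_ok T -> tab_ok (option_insert T o).1.
Proof.
case: o => [x|] //=; elim: T x => [|row T IH] x //.
move=> /andP[/andP[_ srow] okT]; rewrite row_insert_cons.
have := row_bump_sorted x srow; have := row_bump_nonempty row x.
case: (row_bump row x) => -[y|] row' /= n' s'; last by rewrite /row_ok n' s'.
move: (IH y okT) => /=; case: (row_insert T y) => T' r /= ->.
by rewrite /row_ok n' s'.
Qed.

Lemma row_insert_ok (T : tableau) (x : nat) :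
  tab_ok T -> tab_ok (row_insert T x).1.
Proof.
by move/(option_insert_ok (Some x)); rewrite /=; case: (row_insert T x).
Qed.

(** Reverse insertion: the row of the new cell tells whether the first row bumped a letter. The
    upper rows give back that letter, and then [row_bump_inj] gives back the first row and the
    inserted letter. *)
Lemma row_insert_inj (T1 T2 : tableau) (x1 x2 : nat) :
    tab_ok T1 -> tab_ok T2 -> row_insert T1 x1 = row_insert T2 x2 ->
  T1 = T2 /\ x1 = x2.
Proof.
(* Index 0 would mean that [y] was appended to a nonempty row, which then has at least two
   letters. *)
have nil_cons row T x y : row_ok row ->
    row_insert [::] x = row_insert (row :: T) y -> False.
  case/andP=> n _; rewrite row_insert_cons.
  case R: (row_bump row y) => [[b|] row'] /=.
    by case: (row_insert T b).
  by case=> Er _; move: n; have := row_bump_None R; rewrite -Er; case: (row) => // ? [].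
elim: T1 T2 x1 x2 => [|row1 T1 IH] [|row2 T2] x1 x2.
- by move=> _ _ [->].
- by move=> _ /andP[ok _] /nil_cons -/(_ ok).
- by move=> /andP[ok _] _ /esym/nil_cons -/(_ ok).
move=> /andP[/andP[_ s1] ok1] /andP[/andP[_ s2] ok2]; rewrite !row_insert_cons.
case R1: (row_bump row1 x1) => [o1 row1']; case R2: (row_bump row2 x2) => [o2 row2'].
case I1: (option_insert T1 o1) => [T1' r1]; case I2: (option_insert T2 o2) => [T2' r2].
case=> Er ET Err; rewrite {}Er in R1; rewrite {}ET {}Err in I1.
have [ET Eo] : T1 = T2 /\ o1 = o2.
  move: I1 I2; rewrite /option_insert.
  case: o1 {R1} => [y1|]; case: o2 {R2} => [y2|] //=.
  - case F1: (row_insert T1 y1) => [U1 k1] [EU1 Ek1].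
    case F2: (row_insert T2 y2) => [U2 k2] [EU2 Ek2].
    have [|-> -> //] := IH _ _ _ ok1 ok2 (_ : row_insert T1 y1 = row_insert T2 y2).
    by rewrite F1 F2; congr pair; [rewrite EU1|apply: succn_inj; rewrite Ek1].
  - by case: (row_insert T1 y1) => ? ? [_ <-].
  - by case: (row_insert T2 y2) => ? ? [-> <-] [].
  - by case=> -> _ [-> _].
rewrite {}Eo in R1; rewrite ET.
by have [-> ->] := row_bump_inj s1 s2 (etrans R1 (esym R2)).
Qed.

(* The row bumping lemma: descents of a word are visible on the rows of the new
   cells, hence on the recording tableau. *)
Lemma option_insert_row_le (T : tableau) (o1 o2 : option nat) : tab_ok T ->
  let: (T', r1) := option_insert T o1 in
  ((option_insert T' o2).2 <= r1) = ole o1 o2.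
Proof.
elim: T o1 o2 => [|row T IH] [x|] [y|].
- by rewrite /=; case: ltnP.
- by [].
- by [].
- by [].
- case/andP=> /andP[_ srow] okT; rewrite /option_insert row_insert_cons.
  have := row_bump_ole x y srow; case: (row_bump row x) => o row' /=.
  case E: (option_insert T o) => [T' r] <-; move: (IH o (row_bump row' y).1 okT).
  rewrite E row_insert_cons.
  by case: (row_bump row' y) => o' row'' /=; case: (option_insert T' o').
- by move=> _; rewrite /option_insert; case: (row_insert _ x).
- by move=> _; rewrite /option_insert; case: (row_insert _ y).
- by [].
Qed.

Definition insert3 (T : tableau) (o : option nat * option nat * option nat) :=
  let: (o1, o2, o3) := o in
  let: (T1, r1) := option_insert T o1 in
  let: (T2, r2) := option_insert T1 o2 in
  let: (T3, r3) := option_insert T2 o3 in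
  (T3, (r1, r2, r3)).

(** The kind of the move may change from one row to the next, so both swaps are allowed here; the
    descents decide between them in [swapped_dual_triple]. *)
Definition swapped (r r' : nat * nat * nat) : Prop :=
  let: (r1, r2, r3) := r in r' = (r2, r1, r3) \/ r' = (r1, r3, r2).

Lemma insert3_cons (row : seq nat) (T : tableau) (x y z : nat) :
  insert3 (row :: T) (Some x, Some y, Some z) =
    let: (o, row') := row_bump3 row x y z in
    let: (T', (r1, r2, r3)) := insert3 T o in
    (row' :: T', (r1.+1, r2.+1, r3.+1)).
Proof.
rewrite /insert3 /row_bump3 {1}/option_insert row_insert_cons.
case: (row_bump row x) => o1 row1; case E1: (option_insert T o1) => [T1 r1].
rewrite {1}/option_insert row_insert_cons.
case: (row_bump row1 y) => o2 row2; case E2: (option_insert T1 o2) => [T2 r2].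
rewrite {1}/option_insert row_insert_cons.
case: (row_bump row2 z) => o3 row3; case E3: (option_insert T2 o3) => [T3 r3].
by rewrite E1 E2 E3.
Qed.

Lemma swapped_sym r r' : swapped r r' -> swapped r' r.
Proof. by case: r => [[r1 r2] r3] /= [] ->; [left|right]. Qed.

(** Induction on the rows: three finite letters bump triples that are again related by a move,
    perhaps reversed. If one letter is infinite, the move keeps the order of the finite ones, so the
    same insertions are made. *)
Lemma insert3_knuth (T : tableau) o o' : tab_ok T -> knuth_move o o' ->
  (insert3 T o).1 = (insert3 T o').1 /\ swapped (insert3 T o).2 (insert3 T o').2.
Proof.
elim: T o o' => [|row T IH] [[o1 o2] o3] o' ok.
  case=> -[-> {o'}]; case: o1 o2 o3 => [x|] [z|] [y|] //;
    rewrite /olt /= -?ltnNge //.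
  - move=> xy yz; have xz := leq_ltn_trans xy yz.
    rewrite (ltnNge z x) (ltnW xz) /= (ltnNge y x) xy /= yz xz /=.
    by rewrite (ltnNge y x) xy /=; split=> //; right.
  - by move=> xy _; rewrite ltnNge xy /=; split => //; left.
  - move=> zx xy; rewrite zx (ltnNge y x) xy /= zx (ltnNge y z).
    by rewrite (ltnW (leq_trans zx xy)) /=; split => //; right.
  - by move=> zx _; rewrite zx; split => //; right.
  - by split => //; right.
case/andP: ok => /andP[_ srow] okT M.
have bump_case (x1 x2 x3 y1 y2 y3 : nat) :
    (let: (o, row1) := row_bump3 row x1 x2 x3 in
     let: (o', row2) := row_bump3 row y1 y2 y3 in
     row1 = row2 /\ knuth_or_sym o o') ->
    (insert3 (row :: T) (Some x1, Some x2, Some x3)).1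
      = (insert3 (row :: T) (Some y1, Some y2, Some y3)).1
    /\ swapped (insert3 (row :: T) (Some x1, Some x2, Some x3)).2
               (insert3 (row :: T) (Some y1, Some y2, Some y3)).2.
  rewrite !insert3_cons.
  case: (row_bump3 row x1 x2 x3) => o row1; case: (row_bump3 row y1 y2 y3) => o'' row2.
  case=> -> M'.
  have : (insert3 T o).1 = (insert3 T o'').1
         /\ swapped (insert3 T o).2 (insert3 T o'').2.
    case: M' => M'; first exact: IH.
    by have [-> /swapped_sym] := IH _ _ okT M'.
  case: (insert3 T o) => T1 [[r1 r2] r3]; case: (insert3 T o'') => T2 [[r1' r2'] r3'] /=.
  by case=> -> [] [-> -> ->]; split=> //; [left|right].
case: M => -[-> {o'}]; case: o1 o2 o3 => [x|] [z|] [y|] //;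
    rewrite /olt /ole -?ltnNge /insert3 /option_insert //.
- move=> xy yz; apply: bump_case; apply: row_bump3_knuth1 => //; exact/andP.
- move=> _ _; rewrite -/(row_insert (row :: T) x).
  case: (row_insert _ x) => U r; case: (row_insert U y) => U' r'.
  by split=> //; left.
- move=> zx xy; apply: bump_case; apply: row_bump3_knuth2 => //; exact/andP.
- move=> _ _; rewrite -/(row_insert (row :: T) x).
  case: (row_insert _ x) => U r; case: (row_insert U z) => U' r'.
  by split=> //; right.
- move=> _ _; rewrite -/(row_insert (row :: T) z).
  by case: (row_insert _ z) => U r; split=> //; right.
Qed.

(** * Insertion of words *)

(* The second component, the rows of the successive new cells, stands for the
   recording tableau: see [rskE] and [add_cells_inj]. *)
Fixpoint insert_word (T : tableau) (w : seq nat) : tableau * seq nat :=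
  if w is x :: w' then
    let: (T', r) := row_insert T x in
    let: (U, rs) := insert_word T' w' in (U, r :: rs)
  else (T, [::]).

Definition add_cell (Q : tableau) (r : nat) : tableau :=
  set_nth [::] Q r (rcons (nth [::] Q r) (size (flatten Q)).+1).

Lemma rskE (w : seq nat) :
  rsk w = let: (U, rs) := insert_word [::] w in (U, foldl add_cell [::] rs).
Proof.
suff gen P Q : foldl rsk_step (P, Q) w =
    let: (U, rs) := insert_word P w in (U, foldl add_cell Q rs) by exact: gen.
elim: w P Q => //= x w IH P Q.
by case: (row_insert P x) => P' r; rewrite IH; case: (insert_word P' w).
Qed.

Lemma insert_word_ok (T : tableau) (w : seq nat) :
  tab_ok T -> tab_ok (insert_word T w).1.
Proof.
elim: w T => //= x w IH T /(row_insert_ok x).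
by case: (row_insert T x) => T' r /IH; case: (insert_word T' w).
Qed.

Lemma size_insert_word (T : tableau) (w : seq nat) :
  size (insert_word T w).2 = size w.
Proof.
elim: w T => //= x w IH T; case: (row_insert T x) => T' r.
by move: (IH T'); case: (insert_word T' w) => U rs /= ->.
Qed.

Lemma insert_word_cat (T : tableau) (u v : seq nat) :
  insert_word T (u ++ v) =
    let: (U, rs) := insert_word T u in
    let: (V, rs') := insert_word U v in (V, rs ++ rs').
Proof.
elim: u T => [|x u IH] T /=; first by case: (insert_word T v).
case: (row_insert T x) => T' r; rewrite IH.
by case: (insert_word T' u) => U rs; case: (insert_word U v).
Qed.

Lemma insert_word_inj (T1 T2 : tableau) (w1 w2 : seq nat) :
    tab_ok T1 -> tab_ok T2 -> insert_word T1 w1 = insert_word T2 w2 ->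
  T1 = T2 /\ w1 = w2.
Proof.
elim: w1 T1 T2 w2 => [|x1 w1 IH] T1 T2 [|x2 w2] ok1 ok2 /=.
- by case=> ->.
- by case: (row_insert T2 x2) => T r; case: (insert_word T w2).
- by case: (row_insert T1 x1) => T r; case: (insert_word T w1).
have := row_insert_ok x1 ok1; have := row_insert_ok x2 ok2.
have := @row_insert_inj _ _ x1 x2 ok1 ok2.
case: (row_insert T1 x1) => T1' r1; case: (row_insert T2 x2) => T2' r2 /=.
case E1: (insert_word T1' w1) => [U1 rs1]; case E2: (insert_word T2' w2) => [U2 rs2].
move=> inj ok2' ok1' [EU Er Ers].
have [ET ->] : T1' = T2' /\ w1 = w2 by apply: IH; rewrite ?E1 ?E2 ?EU ?Ers.
by have [|-> ->] := inj; rewrite ?ET ?Er.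
Qed.

(** * Recovering the rows of the new cells from the recording tableau *)

Lemma size_flatten_add_cell (Q : tableau) (r : nat) :
  size (flatten (add_cell Q r)) = (size (flatten Q)).+1.
Proof.
(* The new entry is generalized, since it is computed from the whole tableau while the induction
   passes to its upper rows. *)
suff gen m : size (flatten (set_nth [::] Q r (rcons (nth [::] Q r) m)))
             = (size (flatten Q)).+1 by exact: gen.
elim: Q r => [|row Q IH] r.
  by rewrite set_nth_nil nth_nil; elim: r.
by case: r => [|r]; rewrite /= ?size_cat ?size_rcons ?IH ?addnS.
Qed.

Lemma size_add_cells (rs : seq nat) : size (flatten (foldl add_cell [::] rs)) = size rs.
Proof.
elim/last_ind: rs => //= rs r IH.
by rewrite foldl_rcons size_flatten_add_cell IH size_rcons.
Qed.

(** The entry of a new cell counts the cells so far, so the term of index [m] in [rs] places the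
    entry [m.+1]. Hence the rows of the entries spell out [rs]. *)
Lemma mem_add_cells (rs : seq nat) (m r : nat) :
  (m.+1 \in nth [::] (foldl add_cell [::] rs) r) = (m < size rs) && (nth 0 rs m == r).
Proof.
elim/last_ind: rs => [|rs k IH]; first by rewrite /= nth_nil.
rewrite foldl_rcons {1}/add_cell nth_set_nth /= size_add_cells size_rcons nth_rcons.
case: (eqVneq r k) => [Er|nrk].
  rewrite mem_rcons inE eqSS -Er IH ltnS (leq_eqVlt m).
  by case: (ltngtP m (size rs)) => //= _; rewrite eqxx.
rewrite IH ltnS (leq_eqVlt m); case: (ltngtP m (size rs)) => //= _.
by rewrite eq_sym (negbTE nrk).
Qed.

Lemma add_cells_inj (rs rs' : seq nat) :
  foldl add_cell [::] rs = foldl add_cell [::] rs' -> rs = rs'.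
Proof.
move=> E; have Es : size rs = size rs' by rewrite -size_add_cells E size_add_cells.
apply: (@eq_from_nth _ 0) => // m lt_m.
have := mem_add_cells rs m (nth 0 rs m); rewrite E mem_add_cells lt_m -Es lt_m eqxx.
by move/eqP.
Qed.

(** * Knuth moves on words *)

(** The middle value is the witness of the move: in first position it lets the last two letters be
    swapped, in third position the first two. *)
Definition knuth_triple (t : nat * nat * nat) : nat * nat * nat :=
  let: (a, b, c) := t in
  if (b < a < c) || (c < a < b) then (a, c, b)
  else if (b < c < a) || (a < c < b) then (b, a, c)
  else (a, b, c).

(* Elementary dual equivalence on the rows of three successive cells: the
   descents (a < b or b < c) are exchanged, if there is exactly one. *)
Definition dual_triple (t : nat * nat * nat) : nat * nat * nat :=
  let: (a, b, c) := t in
  if (a < b) == (b < c) then (a, b, c)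
  else if ((b < a) != (a < b)) && ((a < c) != (b < c)) then (b, a, c)
  else (a, c, b).

Definition at_triple (f : nat * nat * nat -> nat * nat * nat) (k : nat) (w : seq nat) :=
  let: (a, b, c) := f (nth 0 w k, nth 0 w k.+1, nth 0 w k.+2) in
  take k w ++ [:: a; b; c] ++ drop k.+3 w.

Lemma insert3_descents (T : tableau) o1 o2 o3 : tab_ok T ->
  let: (_, (r1, r2, r3)) := insert3 T (o1, o2, o3) in
  (r2 <= r1) = ole o1 o2 /\ (r3 <= r2) = ole o2 o3.
Proof.
move=> ok; rewrite /insert3.
have := option_insert_row_le o1 o2 ok; have := option_insert_ok o1 ok.
case: (option_insert T o1) => T1 r1 ok1; have := option_insert_row_le o2 o3 ok1.
case: (option_insert T1 o2) => T2 r2 /=.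
by case: (option_insert T2 o3) => T3 r3 /=.
Qed.

(** The inner test of [dual_triple] says that swapping the first two rows exchanges the descents. It
    fails when swapping the last two does so, as [r1 < r3] then agrees with [r2 < r3]. So the
    descents single out the swap. *)
Lemma swapped_dual_triple (r1 r2 r3 r1' r2' r3' : nat) :
    swapped (r1, r2, r3) (r1', r2', r3') -> (r1 < r2) = ~~ (r2 < r3) ->
    (r1' < r2') = (r2 < r3) -> (r2' < r3') = (r1 < r2) ->
  (r1', r2', r3') = dual_triple (r1, r2, r3).
Proof.
rewrite /dual_triple => /= -[] [-> -> ->] nd d1 d2; rewrite nd.
  by rewrite d1 d2 nd; case: ltnP.
by rewrite d1 eqxx andbF; case: ltnP.
Qed.

(** A Knuth move on distinct letters exchanges a descent and an ascent. By [insert3_descents] the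
    rows of the new cells show the same descents, which identifies their swap as [dual_triple]. *)
Lemma insert3_knuth_triple (T : tableau) (a b c : nat) :
    tab_ok T -> uniq [:: a; b; c] ->
  let: (a', b', c') := knuth_triple (a, b, c) in
  insert3 T (Some a', Some b', Some c') =
    let: (U, r) := insert3 T (Some a, Some b, Some c) in (U, dual_triple r).
Proof.
move=> ok; rewrite [uniq _]/= !inE negb_or andbT => /andP[/andP[nab nac] nbc].
have move_case (a' b' c' : nat) :
    (b < a) = ~~ (c < b) -> (a' <= b') = (b <= c) -> (b' <= c') = (a <= b) ->
    knuth_or_sym (Some a, Some b, Some c) (Some a', Some b', Some c') ->
    insert3 T (Some a', Some b', Some c') =
      let: (U, r) := insert3 T (Some a, Some b, Some c) in (U, dual_triple r).
  move=> nd d1' d2' M.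
  have [] : (insert3 T (Some a, Some b, Some c)).1
              = (insert3 T (Some a', Some b', Some c')).1
         /\ swapped (insert3 T (Some a, Some b, Some c)).2
              (insert3 T (Some a', Some b', Some c')).2.
    case: M => M; first exact: insert3_knuth.
    by have [-> /swapped_sym] := insert3_knuth ok M.
  have := insert3_descents (Some a) (Some b) (Some c) ok.
  have := insert3_descents (Some a') (Some b') (Some c') ok.
  case: (insert3 T _) => U' [[r1' r2'] r3']; case: (insert3 T _) => U [[r1 r2] r3].
  rewrite /fst /snd /ole => -[e1' e2'] [e1 e2] -> sw; congr pair.
  by apply: swapped_dual_triple => //; lia.
have := insert3_descents (Some a) (Some b) (Some c) ok.
rewrite /knuth_triple; case: ifP => [abc _|nabc].
  apply: move_case; try lia.
  case/orP: abc => /andP[? ?]; [left|right]; right; split=> //;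
    rewrite /olt /= -?ltnNge; lia.
case: ifP => [abc _|nabc'].
  apply: move_case; try lia.
  case/orP: abc => /andP[? ?]; [right|left]; left; split=> //;
    rewrite /olt /= -?ltnNge; lia.
(* Now [b] is the middle value, so the triple is monotone and [dual_triple] fixes the rows. *)
case: (insert3 T _) => U [[r1 r2] r3]; rewrite /ole => -[e1 e2].
by rewrite /dual_triple ifT //; lia.
Qed.

(** The shift by one comes from [option_insert], which counts rows from the one below; [dual_triple]
    only compares rows and does not see it. *)
Lemma insert_word3 (T : tableau) (a b c : nat) :
  insert3 T (Some a, Some b, Some c) =
    let: (U, rs) := insert_word T [:: a; b; c] in
    (U, ((nth 0 rs 0).+1, (nth 0 rs 1).+1, (nth 0 rs 2).+1)).
Proof.
rewrite /insert3 /=; case: (row_insert T a) => T1 r1 /=.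
by case: (row_insert T1 b) => T2 r2 /=; case: (row_insert T2 c).
Qed.

Lemma cat_take_triple (w : seq nat) (k : nat) : k.+2 < size w ->
  w = take k w ++ [:: nth 0 w k; nth 0 w k.+1; nth 0 w k.+2] ++ drop k.+3 w.
Proof.
move=> lt_k; rewrite -{1}(cat_take_drop k w) (drop_nth 0); last by lia.
by rewrite (drop_nth 0 (n := k.+1)) ?(drop_nth 0 (n := k.+2)) //; lia.
Qed.

Lemma at_triple_cat f (u v : seq nat) (a b c : nat) :
  at_triple f (size u) (u ++ [:: a, b, c & v]) =
    let: (a', b', c') := f (a, b, c) in u ++ [:: a', b', c' & v].
Proof.
have N i : nth 0 (u ++ [:: a, b, c & v]) (size u + i) = nth 0 [:: a, b, c & v] i.
  by rewrite nth_cat ltnNge leq_addr /= addKn.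
rewrite /at_triple take_size_cat // -(add3n (size u)) -drop_drop drop_size_cat //.
by have := (N 0, N 1, N 2); rewrite addn0 addn1 addn2 => -[[-> ->] ->] /=; rewrite drop0.
Qed.

(** The two tableaux agree again after the three letters, so the rest of the word is inserted
    identically. *)
Lemma insert_word_knuth (T : tableau) (k : nat) (w : seq nat) :
    tab_ok T -> uniq w -> k.+2 < size w ->
  insert_word T (at_triple knuth_triple k w) =
    let: (U, rs) := insert_word T w in (U, at_triple dual_triple k rs).
Proof.
move=> ok uw lt_k; rewrite [in RHS](cat_take_triple lt_k) [in LHS]/at_triple.
have : uniq [:: nth 0 w k; nth 0 w k.+1; nth 0 w k.+2].
  by move: uw; rewrite {1}(cat_take_triple lt_k) !cat_uniq => /and3P[_ _ /andP[]].
move: (nth 0 w k) (nth 0 w k.+1) (nth 0 w k.+2) => a b c uabc.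
case K: (knuth_triple (a, b, c)) => [[a' b'] c']; rewrite !insert_word_cat.
case E: (insert_word T (take k w)) => [V ru].
have okV : tab_ok V by have := insert_word_ok (take k w) ok; rewrite E.
have sru : size ru = k.
  have := size_insert_word T (take k w).
  by rewrite E size_take_min (minn_idPl _) //; lia.
have := insert3_knuth_triple okV uabc; rewrite K !insert_word3 !insert_word_cat.
have := size_insert_word V [:: a; b; c]; have := size_insert_word V [:: a'; b'; c'].
case: (insert_word V [:: a; b; c]) => V1 [|r1 [|r2 [|r3 []]]] //.
case: (insert_word V [:: a'; b'; c']) => V2 [|r1' [|r2' [|r3' []]]] // _ _.
case=> -> D; case: (insert_word V1 _) => U rv; rewrite -sru /= at_triple_cat.
move: D; rewrite /dual_triple /nth !ltnS.
by do 2?[case: ifP => _] => -[-> -> ->].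
Qed.

(** A move leaves the middle value in place, so the same swap undoes it. *)
Lemma knuth_tripleK : involutive knuth_triple.
Proof.
case=> [[a b] c]; rewrite /knuth_triple.
case: ifP => [abc|nabc]; first by rewrite orbC abc.
case: ifP => [abc|nabc']; last by rewrite nabc nabc'.
rewrite ifF; first by rewrite orbC abc.
by apply/negbTE; case/orP: abc => /andP[? ?]; lia.
Qed.

Lemma at_tripleK f (k : nat) (w : seq nat) :
  involutive f -> k.+2 < size w -> at_triple f k (at_triple f k w) = w.
Proof.
move=> fK lt_k; have Ew := cat_take_triple lt_k.
have sk : size (take k w) = k by rewrite size_take_min (minn_idPl _) //; lia.
rewrite {2}/at_triple; have := fK (nth 0 w k, nth 0 w k.+1, nth 0 w k.+2).
case: (f (nth 0 w k, _, _)) => [[a b] c] fabc.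
by rewrite /= -{1}sk at_triple_cat fabc -Ew.
Qed.

Lemma size_at_triple f (k : nat) (w : seq nat) :
  k.+2 < size w -> size (at_triple f k w) = size w.
Proof.
move=> lt_k; rewrite /at_triple; case: (f _) => [[a b] c].
by rewrite !size_cat size_take_min size_drop /=; lia.
Qed.

Lemma nth_at_triple f (k m : nat) (w : seq nat) : k.+2 < size w ->
  nth 0 (at_triple f k w) m =
    let: (a, b, c) := f (nth 0 w k, nth 0 w k.+1, nth 0 w k.+2) in
    if m == k then a else if m == k.+1 then b else if m == k.+2 then c else nth 0 w m.
Proof.
move=> lt_k; rewrite /at_triple; case: (f _) => [[a b] c].
have sk : size (take k w) = k by rewrite size_take_min (minn_idPl _) //; lia.
rewrite nth_cat sk; case: (ltnP m k) => mk.
  by rewrite nth_take // !ifF //; apply/eqP; lia.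
rewrite -(subnKC mk) addKn; case: (m - k) => [|[|[|i]]] /=.
- by rewrite addn0 eqxx.
- by rewrite addn1 eqxx ifF //; apply/eqP; lia.
- by rewrite addn2 eqxx !ifF //; apply/eqP; lia.
- by rewrite nth_drop !ifF; [congr nth|..]; try (apply/eqP); lia.
Qed.

(** * Permutations *)

Lemma size_word (n : nat) (s : 'S_n) : size (word s) = n.
Proof. by rewrite size_map size_enum_ord. Qed.

Lemma nth_word (n : nat) (s : 'S_n) (k : 'I_n) : nth 0 (word s) k = (s k).+1.
Proof. by rewrite (nth_map k) ?size_enum_ord // nth_ord_enum. Qed.

Lemma word_inj (n : nat) : injective (@word n).
Proof.
move=> s t E; apply/permP => k; apply: val_inj; apply: succn_inj.
by rewrite -!nth_word E.
Qed.

Lemma uniq_word (n : nat) (s : 'S_n) : uniq (word s).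
Proof.
by rewrite map_inj_uniq ?enum_uniq // => x y /succn_inj /val_inj /perm_inj.
Qed.

Lemma perm_of_wordK (n : nat) (s : 'S_n) : perm_of_word n (word s) = s.
Proof.
rewrite /perm_of_word; case: pickP => [t /eqP /word_inj //|/(_ s)].
by rewrite eqxx.
Qed.

Lemma index_word (n : nat) (s : 'S_n) (a : 'I_n) : index a.+1 (word s) = (s^-1)%g a.
Proof.
have inj : injective (fun k : 'I_n => (s k : nat).+1).
  by move=> x y /succn_inj /val_inj /perm_inj.
by rewrite -{1}(permKV s a) (index_map inj) index_enum_ord.
Qed.

(** * Knuth generators as moves on words *)

Lemma swap_letters_word (n : nat) (s : 'S_n) (a b : 'I_n) :
  swap_letters a.+1 b.+1 (word s) = word (s * tperm a b)%g.
Proof.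
rewrite /swap_letters -map_comp; apply: eq_map => k /=.
rewrite permM !eqSS; case: tpermP => [->|->|/eqP na /eqP nb].
- by rewrite eqxx.
- by rewrite eqxx; case: eqP => // ->.
- by rewrite -!val_eqE /= in na nb; rewrite (negbTE na) (negbTE nb).
Qed.

(** Inversion turns the letters [j-1], [j], [j+1] into positions. As ordinals start at 0, these are
    [i0], [i1], [i2], and [j] is the value of [i2]. *)
Lemma knuthE (n : nat) (s : 'S_n) (i0 i1 i2 : 'I_n) : i1 = i0.+1 :> nat ->
    i2 = i1.+1 :> nat ->
  knuth i2 s =
    if (s i1 < s i0 < s i2) || (s i2 < s i0 < s i1) then (tperm i1 i2 * s)%g
    else if (s i1 < s i2 < s i0) || (s i0 < s i2 < s i1) then (tperm i0 i1 * s)%g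
    else s.
Proof.
move=> E1 E2; have occ (a b : 'I_n) : occurs_before (word s^-1) a.+1 b.+1 = (s a < s b).
  by rewrite /occurs_before !index_word invgK.
(* Each branch is the word of a permutation, so [perm_of_word] never returns its default. *)
have -> : knuth i2 s = (perm_of_word n
    (if (s i1 < s i0 < s i2) || (s i2 < s i0 < s i1) then word (s^-1 * tperm i1 i2)
     else if (s i1 < s i2 < s i0) || (s i0 < s i2 < s i1) then word (s^-1 * tperm i0 i1)
     else word s^-1))^-1%g.
  rewrite -!swap_letters_word -!occ /knuth /d_perm /d_word /occurs_between.
  by rewrite E2 -E1.
case: ifP => _; first by rewrite perm_of_wordK invMg tpermV invgK.
by case: ifP => _; rewrite perm_of_wordK ?invMg ?tpermV invgK.
Qed.

Lemma word_knuth (n k : nat) (s : 'S_n) : k.+2 < n ->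
  word (knuth k.+2 s) = at_triple knuth_triple k (word s).
Proof.
move=> lt_k; have lt_k1 := ltnW lt_k; have lt_k0 := ltnW lt_k1.
pose i0 := Ordinal lt_k0; pose i1 := Ordinal lt_k1; pose i2 := Ordinal lt_k.
have kn : k.+2 < size (word s) by rewrite size_word.
apply: (@eq_from_nth _ 0) => [|m]; rewrite ?size_at_triple ?size_word // => lt_m.
rewrite nth_at_triple // (nth_word s i0) (nth_word s i1) (nth_word s i2).
have -> : m = Ordinal lt_m by []; move: (Ordinal lt_m) => x.
rewrite !nth_word (@knuthE n s i0 i1 i2) // /knuth_triple !ltnS.
rewrite -[x == k :> nat]/(x == i0) -[x == k.+1 :> nat]/(x == i1).
rewrite -[x == k.+2 :> nat]/(x == i2).
have [n10 n20 n21] : [/\ i1 != i0, i2 != i0 & i2 != i1].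
  by rewrite -!val_eqE /=; split; lia.
case: ifP => _; last case: ifP => _.
- rewrite permM; case: tpermP => [->|->|/eqP/negbTE-> /eqP/negbTE->].
  + by rewrite (negbTE n10) eqxx.
  + by rewrite (negbTE n20) (negbTE n21) eqxx.
  + by case: eqP => // ->.
- rewrite permM; case: tpermP => [->|->|/eqP/negbTE-> /eqP/negbTE->].
  + by rewrite eqxx.
  + by rewrite (negbTE n10) eqxx.
  + by case: eqP => // ->.
- by do 3?[case: eqP => [->|_] //].
Qed.

Lemma knuthK (n k : nat) : k.+2 < n -> involutive (@knuth n k.+2).
Proof.
move=> lt_k s; apply: word_inj; rewrite !word_knuth // at_tripleK ?size_word //.
exact: knuth_tripleK.
Qed.

(** * Effect of a Knuth generator on the two tableaux *)

Lemma insert_word_perm_knuth (n k : nat) (s : 'S_n) : k.+2 < n ->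
  insert_word [::] (word (knuth k.+2 s)) =
    let: (U, rs) := insert_word [::] (word s) in (U, at_triple dual_triple k rs).
Proof.
by move=> lt_k; rewrite word_knuth // insert_word_knuth ?uniq_word ?size_word.
Qed.

Lemma Ptab_knuth (n k : nat) (s : 'S_n) : k.+2 < n -> Ptab (knuth k.+2 s) = Ptab s.
Proof.
move=> lt_k; rewrite /Ptab !rskE insert_word_perm_knuth //.
by case: (insert_word _ (word s)).
Qed.

(** The recording tableau determines the rows of the new cells, and the generator changes these by
    [dual_triple] without regard to the letters. *)
Lemma Qtab_knuth (n k : nat) (s t : 'S_n) : k.+2 < n ->
  Qtab s = Qtab t -> Qtab (knuth k.+2 s) = Qtab (knuth k.+2 t).
Proof.
move=> lt_k; rewrite /Qtab !rskE !insert_word_perm_knuth //.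
case: (insert_word _ (word s)) => U rs; case: (insert_word _ (word t)) => V rs' /=.
by move/add_cells_inj ->.
Qed.

Lemma PQtab_inj (n : nat) (s t : 'S_n) : Ptab s = Ptab t -> Qtab s = Qtab t -> s = t.
Proof.
rewrite /Ptab /Qtab !rskE => EP EQ; apply: word_inj.
have [] // := @insert_word_inj [::] [::] (word s) (word t).
move: EP EQ; case: (insert_word _ (word s)) => U rs.
by case: (insert_word _ (word t)) => V rs' /= -> /add_cells_inj ->.
Qed.

Lemma act_on_permP (n : nat) (phi : tableau -> tableau) (s t : 'S_n) :
  Ptab t = phi (Ptab s) -> Qtab t = Qtab s -> act_on_perm phi s = t.
Proof.
move=> EP EQ; rewrite /act_on_perm; case: pickP => [u /andP[/eqP uP /eqP uQ]|/(_ t)].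
  by apply: PQtab_inj; rewrite ?EP ?EQ.
by rewrite EP EQ !eqxx.
Qed.

(* If no permutation has the required pair of tableaux for s, then none has it
   for the image of s either, and both actions return the default value. *)
Lemma knuth_act_on_perm (n k : nat) (phi : tableau -> tableau) (s : 'S_n) : k.+2 < n ->
  knuth k.+2 (act_on_perm phi s) = act_on_perm phi (knuth k.+2 s).
Proof.
move=> lt_k; rewrite {1}/act_on_perm.
case: pickP => [t /andP[/eqP tP /eqP tQ]|no_t] /=.
  by apply/esym/act_on_permP; [rewrite !Ptab_knuth|apply: Qtab_knuth].
rewrite /act_on_perm; case: pickP => [t /andP[/eqP tP /eqP tQ]|//].
have /negP[] := negbT (no_t (knuth k.+2 t)); rewrite Ptab_knuth // tP Ptab_knuth // eqxx.
by apply/eqP; rewrite -[in RHS](knuthK lt_k s); apply: Qtab_knuth.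
Qed.

Theorem proposition2p16 (n j : nat) (hj : 2 <= j <= n - 1) :
  [/\ forall (i : nat) (hi : 2 <= i <= n - 2) (s : 'S_n),
        knuth j (act_on_perm (dR i) s) = act_on_perm (dR i) (knuth j s),
      forall s : 'S_n, knuth j (act_on_perm slink s) = act_on_perm slink (knuth j s)
    & forall s : 'S_n, knuth j (act_on_perm slink_star s) = act_on_perm slink_star (knuth j s)].
Proof.
case: j hj => [|[|k]] // hj; have lt_k : k.+2 < n by lia.
by split=> [i _ s|s|s]; apply: knuth_act_on_perm.
Qed.
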